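(* Let $1\leqslant p\leqslant\infty$, let $X,Y$ be Banach spaces, $A,B:X\to Y$ bounded linear operators, and $K\geqslant1$. (i) For any $\varepsilon>0$, $\mathbf{NP}_p(A+B,X,Y,K)\leqslant\mathbf{NP}_p(A,X,Y)\,\mathbf{NP}_p(B,X,Y,K+\varepsilon)$. (ii) $\mathbf{NP}_1(A+B,X,Y,K)\leqslant\mathbf{NP}_1(A,X,Y,2K)\,\mathbf{NP}_1(B,X,Y,2K)$.
   Context: $B_X$ is the closed unit ball. $(u_i)\lesssim_K(v_i)$ means $\|\sum a_iu_i\|\leqslant K\|\sum a_iv_i\|$ for all scalars. A tree $T$ on a set is a set of finite sequences (the empty sequence allowed) closed under initial segments. $T'$ is $T$ minus its maximal members; $T^0=T$, $T^{\xi+1}=(T^\xi)'$, $T^\xi=\bigcap_{\zeta<\xi}T^\zeta$ for limit $\xi$; $o(T)$ is the least ordinal $\xi$ with $T^\xi=\varnothing$, or $\infty$ if there is none; $\xi<\infty$ and $\xi\infty=\infty\xi=\infty$ for every ordinal $\xi$ (and $\infty\infty=\infty$). Products of ordinals are ordinal products. Let $(e_i)$ be the canonical basis of $\ell_p$ ($c_0$ if $p=\infty$). For an operator $A:X\to Y$ and $K\geqslant1$, $T_p(A,X,Y,K)$ is the tree of finite sequences $(x_i)_{i=1}^n$ in $B_X$ with $(x_i)_{i=1}^n\lesssim_1(e_i)_{i=1}^n$ and $(e_i)_{i=1}^n\lesssim_K(Ax_i)_{i=1}^n$; $\mathbf{NP}_p(A,X,Y,K)=o(T_p(A,X,Y,K))$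 and $\mathbf{NP}_p(A,X,Y)=\sup_{K\geqslant1}\mathbf{NP}_p(A,X,Y,K)$. *)

(* Defs.v *)
From HB Require Import structures.
From mathcomp Require Import all_boot all_order all_algebra.
From mathcomp Require Import all_classical all_reals all_analysis.
From mathcomp Require Import complex.

Set Implicit Arguments.
Unset Strict Implicit.
Unset Printing Implicit Defensive.

Import Order.TTheory GRing.Theory Num.Theory.
Import numFieldNormedType.Exports.

Local Open Scope classical_set_scope.
Local Open Scope ring_scope.

(* Codes for ordinals: zero, successor, and supremum of an arbitrary nonempty
   (not necessarily increasing) small family; [i0] is only there to make the
   family nonempty.  Every ordinal of small cardinality has a code, in general
   several; [ole] compares the ordinals coded, and ordinals are considered up
   to [ole] in both directions. *)
Inductive ord : Type :=
| OZ
| OS of ord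
| OSup (I : Type) (i0 : I) (f : I -> ord).

Inductive ole : ord -> ord -> Prop :=
| ole_zero b : ole OZ b
| ole_succ a b : ole a b -> ole (OS a) (OS b)
| ole_succ_sup a I (i0 : I) g j : ole (OS a) (g j) -> ole (OS a) (OSup i0 g)
| ole_sup I (i0 : I) f b : (forall i, ole (f i) b) -> ole (OSup i0 f) b.

Fixpoint oadd (a b : ord) : ord :=
  match b with
  | OZ => a
  | OS b' => OS (oadd a b')
  | OSup _ i0 g => OSup i0 (fun i => oadd a (g i))
  end.

(* The usual ordinal product: [b] consecutive copies of [a]. *)
Fixpoint omul (a b : ord) : ord :=
  match b with
  | OZ => OZ
  | OS b' => oadd (omul a b') a
  | OSup _ i0 g => OSup i0 (fun i => omul a (g i))
  end.

Inductive eord : Type := Fin of ord | Infty.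

Definition ele (a b : eord) : Prop :=
  match a, b with
  | _, Infty => True
  | Infty, Fin _ => False
  | Fin x, Fin y => ole x y
  end.

(* Here 0 * oo = oo * 0 = oo. *)
Definition emul (a b : eord) : eord :=
  match a, b with
  | Fin x, Fin y => Fin (omul x y)
  | _, _ => Infty
  end.

Definition ofin (a : eord) : ord := if a is Fin x then x else OZ.

Definition esup (I : Type) (i0 : I) (f : I -> eord) : eord :=
  if `[< exists i, f i = Infty >] then Infty
  else Fin (OSup i0 (fun i => ofin (f i))).

Section Trees.
Variable L : eqType.
Implicit Types (T : set (seq L)) (s t : seq L).

Definition maximal_node T s := T s /\ forall t, T t -> prefix s t -> t = s.

Definition derived T : set (seq L) := T `\` [set s | maximal_node T s].

(* [iter_derived] is decreasing along [ole], so its value depends only on the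
   ordinal coded, and for a limit ordinal, coded as the supremum of the smaller
   ones, it is the intersection of the earlier derived trees. *)
Fixpoint iter_derived T (a : ord) : set (seq L) :=
  match a with
  | OZ => T
  | OS b => derived (iter_derived T b)
  | OSup _ _ f => \bigcap_i iter_derived T (f i)
  end.

Definition least_vanishing T (a : ord) :=
  iter_derived T a = set0 /\
  forall b, iter_derived T b = set0 -> ole a b.

(* A code for the least ordinal, unique up to [ole] in both directions. *)
Definition tree_order T : eord :=
  match pselect (exists a, least_vanishing T a) with
  | left h => Fin (projT1 (cid h))
  | right _ => Infty
  end.

End Trees.

Variant scalar_kind := RealScalars | ComplexScalars.

Definition scalars (R : realType) (k : scalar_kind) : numFieldType :=
  match k with
  | RealScalars => R
  | ComplexScalars => R[i]
  end.

(* MathComp norms take their values in the scalar field; over R[i] the value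
   is a nonnegative real number seen as a complex number. *)
Definition to_real (R : realType) (k : scalar_kind) : scalars R k -> R :=
  match k return scalars R k -> R with
  | RealScalars => fun x => x
  | ComplexScalars => fun z => complex.Re z
  end.

Section NP.
Variables (R : realType) (k : scalar_kind).
Local Notation F := (scalars R k).
Implicit Types (p : \bar R) (K : R).

(* The norm of \sum_(i < n) a i *: e_i, where (e_i) is the canonical basis of
   l_p (of c_0 for p = +oo).  Only used for 1 <= p. *)
Definition lp_norm p (n : nat) (a : 'I_n -> F) : R :=
  match p with
  | r%:E => (\sum_(i < n) to_real `|a i| `^ r) `^ r^-1
  | +oo%E => \big[Num.max/0]_(i < n) to_real `|a i|
  | -oo%E => 0
  end.

Definition comb_norm (V : normedModType F) (n : nat) (v : 'I_n -> V)
    (a : 'I_n -> F) : R :=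
  to_real `|\sum_(i < n) a i *: v i|.

(* Domination with constant K of finite sequences (u_i), (v_i), each given by
   the map sending the coefficients (a_i) to the norm of the combination. *)
Definition dominated (n : nat) K (Nu Nv : ('I_n -> F) -> R) :=
  forall a, Nu a <= K * Nv a.

Variables X Y : normedModType F.

Definition Tp p (A : X -> Y) K : set (seq X) :=
  [set s : seq X | [/\ forall x : X, x \in s -> `|x| <= 1,
    dominated 1 (comb_norm (fun i : 'I_(size s) => s`_i)) (@lp_norm p (size s))
    & dominated K (@lp_norm p (size s))
        (comb_norm (fun i : 'I_(size s) => A s`_i))]].

Definition NPK p (A : X -> Y) K : eord := tree_order (Tp p A K).

Definition NP p (A : X -> Y) : eord :=
  @esup {c : R | 1 <= c} (exist _ 1 (lexx 1)) (fun c => NPK p A (sval c)).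

End NP.

(* Main.v *)
Require Import Defs.
From HB Require Import structures.
From mathcomp Require Import all_boot all_order all_algebra.
From mathcomp Require Import all_classical all_reals all_analysis.
From mathcomp Require Import complex.
From mathcomp Require Import ring lra.

Set Implicit Arguments.
Unset Strict Implicit.
Unset Printing Implicit Defensive.

Import Order.TTheory GRing.Theory Num.Theory.
Import numFieldNormedType.Exports.

Local Open Scope classical_set_scope.
Local Open Scope ring_scope.

(** Write T for the tree of A + B with constant K, and let a and b be the
    ordinals attached to A and to B on the right-hand side; if one of them is
    infinite there is nothing to prove.  The b-th derived tree of the tree of B is
    empty, and the point is to deduce that the (a * b)-th derived tree of T is
    empty.

    A node s of T is split into consecutive blocks, and in each block a vector
    of l_p-norm one in the coefficients is chosen, with value u_j in X.  Such
    u_j are again 1-dominated by the l_p basis, and they K-dominate it through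
    A + B.  If moreover A is small enough on the u_j, removing A costs little,
    and (u_j) is a node of the tree of B (isometric_blocks_Tp).

    Small blocks are available because a bounds the order of the tree of A.
    If s lies in the (a * g + a)-th derived tree of T, the tree of those t
    with s ++ t in the (a * g)-th derived tree has a nonempty a-th derived
    tree, so it is not contained in the tree of A with constant c.  A t outside
    that tree carries a normalised combination v with c * |A v| < 1
    (isometric_blocks_step), which is appended to the blocks.  By induction
    on g, a node of the (a * g)-th derived tree of T yields a node of the g-th
    derived tree of the tree of B (iter_derived_omul0); with g = b the former
    must be empty.

    In (i) every constant c is available, since a is the supremum over all of
    them, and the vectors are chosen with the sum of the |A u_j| below
    eps / (K * (K + eps)); this bounds A on the span of the u_j because the
    coefficients are at most the l_p-norm.  For p = 1 it is enough that each
    |A u_j| be at most 1 / (2 * K), because the l_1-norm is the sum of the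
    moduli of the coefficients; the single constant c = 2 * K provides such
    blocks, whence (ii). *)

(** * Ordinal codes are well-ordered *)

(** All inversions of the order at once, by recursion on the shape of the codes:
    direct inversion would leave equalities between dependent pairs, because
    a supremum carries its index type. *)
Lemma ole_inv a b : ole a b ->
  match a with
  | OZ => True
  | OS a' => match b with
             | OZ => False
             | OS b' => ole a' b'
             | OSup _ _ g => exists j, ole (OS a') (g j)
             end
  | OSup _ _ f => forall i, ole (f i) b
  end.
Proof. by case=> // {}a I i0 g j ?; exists j. Qed.

Lemma ole_OSup a I (i0 : I) g j : ole a (g j) -> ole a (OSup i0 g).
Proof.
elim: a => [|a _|J j0 f IHf] le_agj; first exact: ole_zero.
  exact: ole_succ_sup le_agj.
by apply: ole_sup => i; apply: IHf; apply: (ole_inv le_agj).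
Qed.

Lemma ole_trans a b c : ole a b -> ole b c -> ole a c.
Proof.
move=> le_ab; elim: le_ab c => {a b} [b|a b _ IH|a I i0 g j _ IH|I i0 f b _ IH] c.
- by move=> _; apply: ole_zero.
- elim: c => [|c _|J j0 g IHg] le_bc; have := ole_inv le_bc => //.
    by move=> /IH/ole_succ.
  by case=> j le_bg; apply: ole_succ_sup (IHg j le_bg).
- by move=> le_gc; apply: IH; apply: (ole_inv le_gc).
- by move=> le_bc; apply: ole_sup => i; apply: IH.
Qed.

Lemma ole_total a b : ole a b \/ ole (OS b) a.
Proof.
elim: a b => [|a IHa|I i0 f IHf] b; first by left; apply: ole_zero.
- elim: b => [|b _|J j0 g IHg]; first by right; apply/ole_succ/ole_zero.
    by case: (IHa b) => /ole_succ; [left|right].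
  have [[j le_agj]|no_j] := pselect (exists j, ole (OS a) (g j)).
    by left; apply: ole_succ_sup le_agj.
  right; apply/ole_succ/ole_sup => j.
  case: (IHg j) => [le_agj|lt_gja]; last exact: (ole_inv lt_gja).
  by case: no_j; exists j.
- have [[i nle_fib]|no_i] := pselect (exists i, ~ ole (f i) b).
    by right; case: (IHf i b) => // lt_bfi; apply: ole_OSup lt_bfi.
  left; apply: ole_sup => i.
  by have [//|nle_fib] := pselect (ole (f i) b); case: no_i; exists i.
Qed.

Lemma ord_wf a : Acc (fun b c => ole (OS b) c) a.
Proof.
elim: a => [|a IHa|I i0 f IHf]; apply: Acc_intro => b lt_b.
- by have := ole_inv lt_b.
- have le_ba : ole b a := ole_inv lt_b.
  apply: Acc_intro => c lt_cb; apply: (Acc_inv IHa).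
  exact: ole_trans lt_cb le_ba.
- have [i lt_bfi] : exists i, ole (OS b) (f i) := ole_inv lt_b.
  exact: Acc_inv (IHf i) _ lt_bfi.
Qed.

(** What makes the order of a tree a genuine ordinal: a class of codes that is
    inhabited has a least member, up to equivalence. *)
Lemma ord_least (P : ord -> Prop) a :
  P a -> exists2 m, P m & forall b, P b -> ole m b.
Proof.
elim: (ord_wf a) => {}a _ IHa Pa.
have [[b [lt_ba Pb]]|no_b] := pselect (exists b, ole (OS b) a /\ P b).
  exact: IHa lt_ba Pb.
exists a => // b Pb; case: (ole_total a b) => // lt_ba.
by case: no_b; exists b.
Qed.

(** * Derived trees *)

Section Trees.
Variable L : eqType.
Implicit Types (S T : set (seq L)) (s t : seq L) (a b : ord).

Lemma tree_order_Fin T a : tree_order T = Fin a -> iter_derived T a = set0.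
Proof.
rewrite /tree_order; case: pselect => // h [<-].
by case: (cid h) => /= m [].
Qed.

Lemma tree_order_le T a : iter_derived T a = set0 -> ele (tree_order T) (Fin a).
Proof.
move=> Ta0; rewrite /tree_order; case: pselect => [h|no_least] /=.
  by case: (cid h) => /= m [_]; apply.
have [m Tm0 m_least] := ord_least (P := fun b => iter_derived T b = set0) Ta0.
by case: no_least; exists m.
Qed.

Lemma derivedP T s : derived T s <-> T s /\ exists2 t, t != [::] & T (s ++ t).
Proof.
split=> [[Ts nmax]|[Ts [t t_neq0 Tst]]]; split=> //.
- apply: contrapT => no_t; apply: nmax; split=> // _ /[swap] /prefixP[t ->] Tst.
  apply/eqP; rewrite -[X in _ == X]cats0 eqseq_cat // eqxx /=.
  by apply/negP => /negP t_neq0; apply: no_t; exists t.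
- case=> _ /(_ _ Tst (prefix_prefix _ _)) /eqP.
  by rewrite -[X in _ == X]cats0 eqseq_cat // eqxx /= (negPf t_neq0).
Qed.

Lemma iter_derivedS S T a :
  S `<=` T -> iter_derived S a `<=` iter_derived T a.
Proof.
move=> sST; elim: a => [|a IHa|I i0 f IHf] //= s.
  by move=> /derivedP[Ss [t t_neq0 Sst]]; apply/derivedP; split;
    [exact: IHa|exists t => //; exact: IHa].
by move=> Ss i _; apply: IHf; apply: Ss.
Qed.

Lemma iter_derived_sub T a : iter_derived T a `<=` T.
Proof.
elim: a => [|a IHa|I i0 f IHf] //= s; first by case=> /IHa.
by move=> /(_ i0 Logic.I)/IHf.
Qed.

Lemma iter_derivedD T a b :
  iter_derived T (oadd a b) = iter_derived (iter_derived T a) b.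
Proof.
elim: b => [|b IHb|I i0 f IHf] //=; first by rewrite IHb.
by apply: eq_bigcapr => i _; apply: IHf.
Qed.

(** The subtree above a node keeps at least the rank of that node: appending s
    maps extensions of t in the subtree to extensions of s ++ t. *)
Lemma iter_derived_shift T s t a :
  iter_derived T a (s ++ t) -> iter_derived [set r | T (s ++ r)] a t.
Proof.
elim: a t => [|a IHa|I i0 f IHf] //= t.
  move=> /derivedP[Tst [r r_neq0 Tstr]]; apply/derivedP; split; first exact: IHa.
  by exists r => //; apply: IHa; rewrite catA.
by move=> Tst i _; apply: IHf; apply: Tst.
Qed.

End Trees.

(** The ordinal skeleton of the argument.  A relation [good] between nodes of T
    and nodes of U allows a node of U to be prolonged whenever a node of T is
    prolonged inside T by a sequence escaping some tree of order at most a.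
    Then [a] derivations of T account for one derivation of U. *)
Lemma iter_derived_omul0 (L M : eqType) (T : set (seq L)) (U : set (seq M))
    (good : seq L -> seq M -> Prop) (a b : ord) :
  (forall s, good s [::]) ->
  (forall s u, T s -> good s u -> U u) ->
  (forall s u, T s -> good s u -> exists2 S, iter_derived S a = set0 &
     forall t, T (s ++ t) -> ~ S t -> exists v, good (s ++ t) (rcons u v)) ->
  iter_derived U b = set0 -> iter_derived T (omul a b) = set0.
Proof.
move=> good0 goodU goodS Ub0; apply: contrapT => /eqP/set0P[s Ts].
suff transfer u : good s u -> iter_derived U b u.
  by have := transfer _ (good0 s); rewrite Ub0.
elim: b {Ub0} s u Ts => [|b IHb|I i0 f IHf] /= s u Ts gsu.
- exact: goodU gsu.
- rewrite iter_derivedD in Ts; have Tbs := iter_derived_sub Ts.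
  apply/derivedP; split; first exact: IHb gsu.
  have [S Sa0 step] := goodS _ _ (iter_derived_sub Tbs) gsu.
  (* Otherwise the subtree above s is contained in S, and its a-th derived tree,
     which contains the empty sequence, would be empty. *)
  have [t /= Tst nSt] : exists2 t, iter_derived T (omul a b) (s ++ t) & ~ S t.
    apply: contrapT => no_t.
    suff /iter_derivedS : [set r | iter_derived T (omul a b) (s ++ r)] `<=` S.
      move=> /(_ a [::]); rewrite Sa0; apply.
      by apply: iter_derived_shift; rewrite cats0.
    by move=> t /= Tst; apply: contrapT => nSt; apply: no_t; exists t.
  have [v gv] := step _ (iter_derived_sub Tst) nSt.
  by exists [:: v] => //; rewrite cats1; apply: IHb gv.
- by move=> i _; apply: IHf gsu; apply: Ts.
Qed.

(** * Real-valued norms over the scalar field *)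

Section Sequences.
Variables (R : realType) (k : scalar_kind).
Local Notation F := (scalars R k).
(* The norm as an element of R; the same notation serves vectors and scalars. *)
Local Notation nm x := (to_real `|x|).
Implicit Types (p : \bar R) (a b c : seq F) (K : R).

Lemma to_real0 : to_real (0 : F) = 0. Proof. by case: k. Qed.

Lemma to_real1 : to_real (1 : F) = 1. Proof. by case: k. Qed.

Lemma to_realD (x y : F) : to_real (x + y) = to_real x + to_real y.
Proof. by move: x y; case: k => //= -[a b] [c d]. Qed.

Lemma ler_to_real (x y : F) : x <= y -> to_real x <= to_real y.
Proof. by move: x y; case: k => //= x y; rewrite lecE => /andP[]. Qed.

Lemma to_realM (x y : F) : 0 <= x -> to_real (x * y) = to_real x * to_real y.
Proof.
move: x y; case: k => //= -[a b] [c d]; rewrite lecE /= => /andP[/eqP -> _].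
by rewrite mul0r subr0.
Qed.

Lemma to_real_le1 (x : F) : 0 <= x -> (x <= 1) = (to_real x <= 1).
Proof.
move: x; case: k => //= -[a b]; rewrite !lecE /= => /andP[/eqP -> _].
by rewrite eqxx.
Qed.

Lemma scalar_of_norm (r : R) : 0 <= r -> exists z : F, nm z = r.
Proof.
move=> r_ge0; case: k; first by exists r; apply: (ger0_norm r_ge0).
exists r%:C%C; apply: (congr1 (@complex.Re R) (ger0_norm _)).
by rewrite ler0c.
Qed.

Section Norm.
Variable V : normedModType F.
Implicit Types x y : V.

Lemma nm_ge0 x : 0 <= nm x.
Proof. by rewrite -to_real0; apply: ler_to_real. Qed.

Lemma nm0 : nm (0 : V) = 0.
Proof. by rewrite normr0 to_real0. Qed.

Lemma nmD x y : nm (x + y) <= nm x + nm y.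
Proof. by rewrite -to_realD; apply: ler_to_real; apply: ler_normD. Qed.

Lemma nmZ (z : F) x : nm (z *: x) = nm z * nm x.
Proof. by rewrite normrZ to_realM. Qed.

Lemma nm_le1 x : (`|x| <= 1) = (nm x <= 1).
Proof. exact: to_real_le1. Qed.

End Norm.

Lemma nms_ge0 (z : F) : 0 <= nm z.
Proof. by rewrite -to_real0; apply: ler_to_real. Qed.

Lemma nms0 : nm (0 : F) = 0.
Proof. by rewrite normr0 to_real0. Qed.

Lemma nms1 : nm (1 : F) = 1.
Proof. by rewrite normr1 to_real1. Qed.

Lemma nmsM (y z : F) : nm (y * z) = nm y * nm z.
Proof. by rewrite normrM to_realM. Qed.

(** * The l_p norm and linear combinations of finite sequences *)

(** Coefficients are kept in a sequence rather than in a function on ordinals,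
    so that joining blocks is concatenation. *)
Definition lp_seq p a : R :=
  match p with
  | r%:E => (\sum_(z <- a) nm z `^ r) `^ r^-1
  | +oo%E => \big[Num.max/0]_(z <- a) nm z
  | -oo%E => 0
  end.

Lemma lp_normE p a :
  lp_norm p (fun i : 'I_(size a) => a`_i) = lp_seq p a.
Proof. by case: p => [r||] //=; rewrite (big_nth 0) big_mkord. Qed.

Lemma lp_seq_ge0 p a : 0 <= lp_seq p a.
Proof.
case: p => [r||] //=; first exact: powR_ge0.
by elim/big_rec: _ => // z m _ _; rewrite le_max nms_ge0.
Qed.

Section Exponent.
Variable p : \bar R.
Hypothesis p_ge1 : (1 <= p)%E.

(** The only trace of the l_p structure on which blocking depends: the norm of a
    concatenation is determined by the norms of the two parts. *)
Lemma lp_seq_cat_congr a a' c c' :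
  lp_seq p a = lp_seq p a' -> lp_seq p c = lp_seq p c' ->
  lp_seq p (a ++ c) = lp_seq p (a' ++ c').
Proof.
case: p p_ge1 => [r||] //=.
  rewrite lee_fin => r_ge1; rewrite !big_cat /=.
  have powK x y : 0 <= x -> 0 <= y -> x `^ r^-1 = y `^ r^-1 -> x = y.
    move=> x_ge0 y_ge0 /(congr1 (@powR R ^~ r)).
    by rewrite -!powRrM mulVf ?powRr1 // gt_eqF //; lra.
  have sum_ge0 b : 0 <= \sum_(z <- b) nm z `^ r.
    by apply: sumr_ge0 => z _; apply: powR_ge0.
  by move=> /powK-> // /powK->.
have maxcat b d : \big[Num.max/0]_(z <- b ++ d) nm z =
    Num.max (\big[Num.max/0]_(z <- b) nm z) (\big[Num.max/0]_(z <- d) nm z).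
  elim: b => [|z b IHb]; last by rewrite /= !big_cons IHb maxA.
  by rewrite /= big_nil max_r //; apply: (lp_seq_ge0 +oo%E).
by rewrite !maxcat => _ -> ->.
Qed.

Lemma lp_seqZ (z : F) a : lp_seq p [seq z * x | x <- a] = nm z * lp_seq p a.
Proof.
case: p p_ge1 => [r||] //=.
  rewrite lee_fin => r_ge1; rewrite big_map.
  under eq_bigr do rewrite nmsM powRM ?nms_ge0 //.
  rewrite -big_distrr /= powRM ?powR_ge0 //; last first.
    by apply: sumr_ge0 => x _; apply: powR_ge0.
  by rewrite -powRrM mulfV ?powRr1 ?nms_ge0 // gt_eqF //; lra.
move=> _; rewrite big_map; elim: a => [|x a IHa]; first by rewrite !big_nil mulr0.
by rewrite !big_cons IHa maxr_pMr ?nms_ge0 // nmsM.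
Qed.

Lemma lp_seq1 (z : F) : lp_seq p [:: z] = nm z.
Proof.
case: p p_ge1 => [r||] //=.
  rewrite lee_fin => r_ge1; rewrite big_seq1.
  by rewrite -powRrM mulfV ?powRr1 ?nms_ge0 // gt_eqF //; lra.
by move=> _; rewrite big_cons big_nil max_l ?nms_ge0.
Qed.

Lemma lp_seq_nil : lp_seq p [::] = 0.
Proof.
case: p p_ge1 => [r||] //=; last by rewrite big_nil.
by rewrite lee_fin big_nil => r_ge1; rewrite powR0 // gt_eqF // invr_gt0; lra.
Qed.

Lemma lp_seq_nseq0 n : lp_seq p (nseq n 0) = 0.
Proof.
have -> : nseq n 0 = [seq (0 : F) * x | x <- nseq n 0] by rewrite map_nseq mulr0.
by rewrite lp_seqZ nms0 mul0r.
Qed.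

Lemma lp_seq_nseq0_cat n a : lp_seq p (nseq n 0 ++ a) = lp_seq p a.
Proof.
by apply: (@lp_seq_cat_congr _ [::]); rewrite // lp_seq_nseq0 lp_seq_nil.
Qed.

Lemma lp_seq_cat_nseq0 n a : lp_seq p (a ++ nseq n 0) = lp_seq p a.
Proof.
rewrite -[in RHS](cats0 a).
by apply: lp_seq_cat_congr; rewrite // lp_seq_nseq0 lp_seq_nil.
Qed.

Lemma nm_le_lp_seq a (z : F) : z \in a -> nm z <= lp_seq p a.
Proof.
case: p p_ge1 => [r||] //=.
  rewrite lee_fin => r_ge1 a_z.
  have -> : nm z = (nm z `^ r) `^ r^-1.
    by rewrite -powRrM mulfV ?powRr1 ?nms_ge0 // gt_eqF //; lra.
  apply: ge0_ler_powR; rewrite ?nnegrE ?powR_ge0 ?invr_ge0 //; first by lra.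
    by apply: sumr_ge0 => x _; apply: powR_ge0.
  rewrite (big_rem z a_z) /= lerDl.
  by apply: sumr_ge0 => x _; apply: powR_ge0.
by move=> _ a_z; apply: (le_bigmax_seq 0 z xpredT (fun z => nm z)).
Qed.

End Exponent.

Lemma lp_seq_1E a : lp_seq 1%:E a = \sum_(z <- a) nm z.
Proof.
rewrite /= invr1 powRr1; last by apply: sumr_ge0 => z _; apply: powR_ge0.
by apply: eq_bigr => z _; rewrite powRr1 ?nms_ge0.
Qed.

Section Combinations.
Variable V : lmodType F.
Implicit Types (s t : seq V) (v : V).

Definition comb a s : V := \sum_(q <- zip a s) q.1 *: q.2.

Lemma comb_cat a c s t :
  size a = size s -> comb (a ++ c) (s ++ t) = comb a s + comb c t.
Proof. by move=> sz; rewrite /comb zip_cat // big_cat. Qed.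

Lemma comb1 (z : F) v : comb [:: z] [:: v] = z *: v.
Proof. by rewrite /comb big_seq1. Qed.

Lemma combZ (z : F) a s : comb [seq z * x | x <- a] s = z *: comb a s.
Proof.
rewrite /comb scaler_sumr.
elim: a s => [|x a IHa] [|v s] //=; rewrite ?big_nil // !big_cons IHa.
by rewrite scalerA.
Qed.

Lemma comb_nseq0 n s : comb (nseq n 0) s = 0.
Proof.
elim: n s => [|n IHn] [|v s]; rewrite /comb ?big_nil //= big_cons scale0r add0r.
exact: IHn.
Qed.

Lemma combE a s :
  size a = size s -> comb a s = \sum_(i < size s) a`_i *: s`_i.
Proof.
move=> sz; rewrite /comb (big_nth (0, 0)) size_zip sz minnn big_mkord.
by apply: eq_bigr => i _; rewrite nth_zip.
Qed.

End Combinations.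

Lemma comb_map (V W : lmodType F) (A : {linear V -> W}) a (s : seq V) :
  comb a (map A s) = A (comb a s).
Proof.
rewrite /comb linear_sum; elim: a s => [|x a IHa] [|v s]; rewrite ?big_nil //=.
by rewrite !big_cons IHa linearZ.
Qed.

Lemma nm_comb_cons (V W : normedModType F) (A : {linear V -> W}) z a v s :
  nm (A (comb (z :: a) (v :: s))) <= nm z * nm (A v) + nm (A (comb a s)).
Proof.
rewrite {1}/comb /= big_cons linearD linearZ /= -nmZ; exact: nmD.
Qed.

(** Coefficients are at most the l_p-norm, so A is controlled on the span of s by
    the sum of its values on s. *)
Lemma nm_comb_le_lp (p : \bar R) (V W : normedModType F) (A : {linear V -> W})
    a (s : seq V) :
  (1 <= p)%E -> nm (A (comb a s)) <= (\sum_(v <- s) nm (A v)) * lp_seq p a.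
Proof.
move=> p_ge1; have := fun z => @nm_le_lp_seq p p_ge1 a z.
elim: a (lp_seq p a) s (lp_seq_ge0 p a) => [|z a IHa] M [|v s] M_ge0 le_M;
  rewrite ?big_nil ?mul0r; try by rewrite /comb big_nil linear0 nm0.
  rewrite /comb big_nil linear0 nm0 mulr_ge0 // sumr_ge0 // => w _; exact: nm_ge0.
apply: le_trans (nm_comb_cons _ _ _ _ _) _; rewrite big_cons mulrDl lerD //.
  by rewrite mulrC ler_wpM2l ?nm_ge0 ?le_M ?mem_head.
by apply: IHa => // y a_y; apply: le_M; rewrite inE a_y orbT.
Qed.

(** In l_1 a uniform bound on the vectors is as good as a summable one. *)
Lemma nm_comb_le_l1 (V W : normedModType F) (A : {linear V -> W}) d a (s : seq V) :
  0 <= d -> (forall v, v \in s -> nm (A v) <= d) ->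
  nm (A (comb a s)) <= d * lp_seq 1%:E a.
Proof.
move=> d_ge0; rewrite lp_seq_1E.
elim: a s => [|z a IHa] [|v s] le_d;
  try by rewrite /comb big_nil linear0 nm0 mulr_ge0 // sumr_ge0 // => y _; exact: nms_ge0.
apply: le_trans (nm_comb_cons _ _ _ _ _) _; rewrite big_cons mulrDr lerD //.
  by rewrite mulrC ler_wpM2r ?nms_ge0 ?le_d ?mem_head.
by apply: IHa => // w s_w; apply: le_d; rewrite inE s_w orbT.
Qed.

(** * Normalised blocks of the nodes of the trees *)

Section Tree_of_lp_sequences.
Variables (p : \bar R) (X Y : normedModType F).
Hypothesis p_ge1 : (1 <= p)%E.
Implicit Types (A B : {linear X -> Y}) (s t u : seq X) (v : X).

Definition sub_lp s := forall a, size a = size s -> nm (comb a s) <= lp_seq p a.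

Definition super_lp A K s :=
  forall a, size a = size s -> lp_seq p a <= K * nm (A (comb a s)).

(** The vector v is the combination of s with a unit vector as coefficients. *)
Lemma sub_lp_ball s v : sub_lp s -> v \in s -> nm v <= 1.
Proof.
move=> + s_v; case/path.splitP: s_v => {}s t; rewrite -cats1 -catA => sub_s.
have := sub_s (nseq (size s) 0 ++ [:: 1] ++ nseq (size t) 0).
rewrite !size_cat !size_nseq => /(_ erefl).
rewrite lp_seq_nseq0_cat // lp_seq_cat_nseq0 // lp_seq1 // nms1.
by rewrite !comb_cat ?size_nseq // !comb_nseq0 comb1 scale1r add0r addr0.
Qed.

Lemma sub_lp_cat s t : sub_lp (s ++ t) -> sub_lp t.
Proof.
move=> sub_st a sz; have := sub_st (nseq (size s) 0 ++ a).
rewrite !size_cat size_nseq sz => /(_ erefl).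
by rewrite lp_seq_nseq0_cat // comb_cat ?size_nseq // comb_nseq0 add0r.
Qed.

(** The vectors of s lie in the unit ball by the first domination applied to unit
    vectors, see [sub_lp_ball]. *)
Lemma TpP A K s : Tp p A K s <-> sub_lp s /\ super_lp A K s.
Proof.
have seq_of (a : 'I_(size s) -> F) :
    exists2 b, size b = size s & a = fun i => b`_i.
  exists [seq a i | i <- enum 'I_(size s)]; first by rewrite size_map size_enum_ord.
  apply/funext => i.
  by rewrite (nth_map i) ?size_enum_ord // nth_ord_enum.
have lpE b : size b = size s -> lp_norm p (fun i : 'I_(size s) => b`_i) = lp_seq p b.
  by move=> <-; apply: lp_normE.
have AE b : size b = size s ->
    comb_norm (fun i : 'I_(size s) => A s`_i) (fun i => b`_i) = nm (A (comb b s)).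
  move=> sz; rewrite -comb_map combE ?size_map //.
  by congr (nm _); apply: eq_bigr => i _; rewrite (nth_map 0).
split=> [[_ dom1 domA]|[sub_s super_s]].
- split=> b sz.
    by have := dom1 (fun i => b`_i); rewrite lpE // mul1r combE.
  by have := domA (fun i => b`_i); rewrite lpE // AE.
- split=> [v s_v|a|a].
  + by rewrite nm_le1; apply: sub_lp_ball s_v.
  + have [b sz ->] := seq_of a; rewrite lpE // mul1r /comb_norm -combE //.
    exact: sub_s.
  + have [b sz ->] := seq_of a; rewrite lpE // AE //; exact: super_s.
Qed.

(** The effect of u being a sequence of normalised blocks of s, without naming the
    blocks: the span of u sits in the span of s, isometrically for the l_p-norms
    of the coefficients.  This is all that the domination inequalities see. *)
Definition isometric_blocks s u := forall b, size b = size u ->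
  exists a, [/\ size a = size s, comb a s = comb b u & lp_seq p a = lp_seq p b].

Lemma isometric_blocks_nil s : isometric_blocks s [::].
Proof.
move=> b /size0nil ->; exists (nseq (size s) 0).
by rewrite size_nseq comb_nseq0 lp_seq_nseq0 // lp_seq_nil // /comb big_nil.
Qed.

Lemma isometric_blocks_rcons s u t c :
  isometric_blocks s u -> size c = size t -> lp_seq p c = 1 ->
  isometric_blocks (s ++ t) (rcons u (comb c t)).
Proof.
move=> blk szc lpc b; rewrite size_rcons; case/lastP: b => // b z.
rewrite size_rcons => -[/[dup] szb /blk[a [sza comb_a lpa]]].
exists (a ++ [seq z * x | x <- c]); split.
- by rewrite !size_cat size_map sza szc.
- by rewrite -!cats1 !comb_cat // combZ comb1 comb_a.
- rewrite -cats1; apply: lp_seq_cat_congr => //.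
  by rewrite lp_seqZ // lpc mulr1 lp_seq1.
Qed.

(** Coefficients violating the lower estimate, divided by their l_p-norm; that norm
    is positive since it exceeds a nonnegative number. *)
Lemma not_super_lp A K t : 0 <= K -> ~ super_lp A K t ->
  exists c, [/\ size c = size t, lp_seq p c = 1 & K * nm (A (comb c t)) < 1].
Proof.
move=> K_ge0 nsuper; have [a sza lt_a] :
    exists2 a, size a = size t & K * nm (A (comb a t)) < lp_seq p a.
  apply: contrapT => no_a; apply: nsuper => a sza.
  by rewrite leNgt; apply/negP => lt_a; apply: no_a; exists a.
have lpa_gt0 : 0 < lp_seq p a.
  by apply: le_lt_trans lt_a; rewrite mulr_ge0 ?nm_ge0.
have [z nm_z] : exists z : F, nm z = (lp_seq p a)^-1.
  by apply: scalar_of_norm; rewrite invr_ge0 ltW.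
exists [seq z * x | x <- a]; split; first by rewrite size_map.
  by rewrite lp_seqZ // nm_z mulVf ?gt_eqF.
by rewrite combZ linearZ nmZ nm_z mulrCA mulrC ltr_pdivrMr ?mul1r.
Qed.

(** A suffix of a node always satisfies the upper estimate, so outside the tree of A
    it must violate the lower one. *)
Lemma isometric_blocks_step A K s t u :
  0 <= K -> sub_lp (s ++ t) -> isometric_blocks s u -> ~ Tp p A K t ->
  exists2 v, isometric_blocks (s ++ t) (rcons u v) & K * nm (A v) < 1.
Proof.
move=> K_ge0 /sub_lp_cat sub_t blk nTt.
have [|c [szc lpc lt_c]] := @not_super_lp A K t K_ge0.
  by move=> super_t; apply/nTt/TpP.
by exists (comb c t) => //; apply: isometric_blocks_rcons.
Qed.

(** On a combination of u the operators B and A + B differ by at most d times the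
    l_p-norm of the coefficients.  The lower estimate 1 / K thus becomes 1 / K - d,
    that is, K is replaced by K / (1 - K * d). *)
Lemma isometric_blocks_Tp A B (d K K' : R) s u :
  Tp p (A \+ B) K s -> isometric_blocks s u ->
  0 <= K -> K * d < 1 -> K <= K' * (1 - K * d) ->
  (forall b, nm (A (comb b u)) <= d * lp_seq p b) ->
  Tp p B K' u.
Proof.
move=> /TpP[sub_s super_s] blk K_ge0 Kd_lt1 le_KK' small_A; apply/TpP; split=> b szb.
  by have [a [sza <- <-]] := blk _ szb; apply: sub_s.
have [a [sza comb_a lp_a]] := blk _ szb.
have := super_s a sza; rewrite comb_a lp_a => le_b.
have le_sum : nm (A (comb b u) + B (comb b u)) <= d * lp_seq p b + nm (B (comb b u)).
  by apply: le_trans (nmD _ _) _; rewrite lerD2r small_A.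
have le_1 : (1 - K * d) * lp_seq p b <= K * nm (B (comb b u)).
  rewrite mulrBl mul1r lerBlDl; apply: le_trans le_b _.
  by rewrite -mulrA -mulrDr ler_wpM2l.
have le_2 := ler_wpM2r (nm_ge0 (B (comb b u))) le_KK'.
rewrite -(ler_pM2l (x := 1 - K * d)) ?subr_gt0 //.
by apply: le_trans le_1 _; rewrite mulrCA mulrA.
Qed.

(** The estimate common to both parts.  The predicate [small] is the requirement on
    the chosen vectors: it must make A small on their span, and it must survive
    the addition of a vector on which A is small enough, how small depending on
    the vectors chosen before. *)
Lemma NPK_add_le A B (d K K' : R) (small : seq X -> Prop) x y :
  0 <= K -> K * d < 1 -> K <= K' * (1 - K * d) ->
  small [::] ->
  (forall u b, small u -> nm (A (comb b u)) <= d * lp_seq p b) ->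
  (forall u, small u -> exists2 c : R, 0 <= c /\ iter_derived (Tp p A c) x = set0 &
     forall v, c * nm (A v) < 1 -> small (rcons u v)) ->
  NPK p B K' = Fin y -> ele (NPK p (A \+ B) K) (Fin (omul x y)).
Proof.
move=> K_ge0 Kd_lt1 le_KK' small0 small_le small_step /tree_order_Fin TB0.
apply: tree_order_le.
apply: (iter_derived_omul0 (U := Tp p B K')
  (good := fun s u => isometric_blocks s u /\ small u)) TB0 =>
  [s|s u Ts [blk su]|s u Ts [blk su]].
- by split=> //; apply: isometric_blocks_nil.
- by apply: (isometric_blocks_Tp (d := d) Ts blk) => // b; apply: small_le.
- have [c [c_ge0 TA0] next_small] := small_step u su; exists (Tp p A c) => //.
  move=> t /(TpP (A \+ B))[sub_st _] nTt.
  have [v blk_v /next_small small_v] := isometric_blocks_step c_ge0 sub_st blk nTt.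
  by exists v.
Qed.

Lemma NP_Fin A x (c : R) :
  NP p A = Fin x -> 1 <= c -> iter_derived (Tp p A c) x = set0.
Proof.
rewrite /NP /esup; case: asboolP => // fin_NPK [<-] c_ge1.
apply/seteqP; split=> // s Ts.
have : iter_derived (Tp p A c) (ofin (NPK p A c)) s.
  exact: Ts (exist _ c c_ge1) Logic.I.
case NPK_c: (NPK p A c) => [z|]; first by rewrite (tree_order_Fin NPK_c).
by case: fin_NPK; exists (exist _ c c_ge1).
Qed.

End Tree_of_lp_sequences.

End Sequences.

(** * The order of the tree of a sum *)

Theorem lemma3p3 (R : realType) (k : scalar_kind) (p : \bar R)
    (hp : (1 <= p)%E) (X Y : completeNormedModType (scalars R k))
    (A B : {linear X -> Y})
    (hA : bounded_near A (nbhs (0 : X))) (hB : bounded_near B (nbhs (0 : X)))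
    (K : R) (hK : 1 <= K) :
  (forall eps : R, 0 < eps ->
     ele (NPK p (A \+ B) K) (emul (NP p A) (NPK p B (K + eps)))) /\
  ele (NPK 1%:E (A \+ B) K) (emul (NPK 1%:E A (2 * K)) (NPK 1%:E B (2 * K))).
Proof.
have K_gt0 : 0 < K by lra.
split=> [eps eps_gt0|].
- case NPA: (NP p A) => [x|]; last by case: (NPK p (A \+ B) K).
  case NPB: (NPK p B (K + eps)) => [y|]; last by case: (NPK p (A \+ B) K).
  (* The solution of K / (1 - K * d) = K + eps. *)
  set d := eps / (K * (K + eps)).
  have d_gt0 : 0 < d by rewrite divr_gt0 // mulr_gt0 // addr_gt0.
  have Kd : 1 - K * d = K / (K + eps).
    by rewrite /d; field; rewrite !gt_eqF // addr_gt0.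
  have Kd_gt0 : 0 < 1 - K * d by rewrite Kd divr_gt0 // addr_gt0.
  apply: (NPK_add_le hp (d := d) (K' := K + eps)
    (small := fun u => \sum_(v <- u) to_real `|A v| < d)) NPB => //.
  + exact: ltW.
  + by rewrite -subr_gt0.
  + by rewrite Kd mulrCA mulfV ?mulr1 // gt_eqF // addr_gt0.
  + by rewrite big_nil.
  + move=> u b su; apply: le_trans (nm_comb_le_lp _ _ _ hp) _.
    by rewrite ler_wpM2r ?lp_seq_ge0 // ltW.
  (* The inverse of the margin left below d; adding 1 makes the constant at
     least 1. *)
  + move=> u su; exists (1 + (d - \sum_(v <- u) to_real `|A v|)^-1).
      split; [|apply: (NP_Fin NPA)].
        by rewrite addr_ge0 // invr_ge0 subr_ge0 ltW.
      by rewrite lerDl invr_ge0 subr_ge0 ltW.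
    move=> v lt_v; rewrite -cats1 big_cat big_seq1 /= -ltrBrDl.
    rewrite -subr_gt0 in su; rewrite -[X in _ < X]mulr1 -ltr_pdivrMl //.
    by apply: le_lt_trans lt_v; rewrite mulrDl mul1r lerDr nm_ge0.
- case NPA: (NPK 1%:E A (2 * K)) => [x|]; last by case: (NPK 1%:E (A \+ B) K).
  case NPB: (NPK 1%:E B (2 * K)) => [y|]; last by case: (NPK 1%:E (A \+ B) K).
  have KV : K * (2 * K)^-1 = 2^-1 by field; rewrite gt_eqF.
  apply: (NPK_add_le (lexx 1%:E) (d := (2 * K)^-1) (K' := 2 * K)
    (small := fun u => forall v, v \in u -> 2 * K * to_real `|A v| < 1)) NPB => //.
  + exact: ltW.
  + by rewrite KV; lra.
  + by rewrite KV; lra.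
  + move=> u b su; apply: nm_comb_le_l1 => [|v /su lt_v].
      by rewrite invr_ge0; lra.
    by rewrite -[X in _ <= X]mul1r ler_pdivlMr 1?mulrC ?ltW //; lra.
  + move=> u su; exists (2 * K); first split; [lra|exact: tree_order_Fin|].
    by move=> v lt_v w; rewrite mem_rcons inE => /predU1P[->|/su].
Qed.
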